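(* Let $G=(V,E)$ be a finite simple connected graph. For fixed probability density vectors $\mu,\nu:V\to\mathbb{R}$, let $$X:=\{T\in\mathcal{T}(G):\mathcal{W}_T(\mu,\nu)=\mathcal{W}_G(\mu,\nu)\}.$$ Then the induced subgraph $\mathbb{T}[X]$ of the spanning tree state graph $\mathbb{T}=\mathbb{T}(G)$ is connected.
   Context: A probability density vector on $V$ is a nonnegative function on $V$ summing to $1$. For a connected graph $H$ on vertex set $V$ with shortest path metric $d_H$ (unit edge lengths), $\mathcal{W}_H(\mu,\nu)=\inf_{\pi\in\Pi(\mu,\nu)}\sum_{x,y\in V}\pi(x,y)d_H(x,y)$, where $\Pi(\mu,\nu)\subseteq\mathbb{R}^{V\times V}$ is the set of couplings of $\mu$ and $\nu$. A spanning tree of $G$ is a set $T\subseteq E$ such that $(V,T)$ is connected and acyclic; $\mathcal{T}(G)$ is the set of spanning trees, and $\mathcal{W}_T$ means $\mathcal{W}_{(V,T)}$. The spanning tree state graph $\mathbb{T}(G)$ has node set $\mathcal{T}(G)$, and two distinct spanning trees $S,T$ are adjacent ($S\sim T$) iff they differ by a single edge exchange, i.e. $S=(T\cup\{f\})\setminus\{e\}$ for some $f\in E\setminus T$, $e\in T$. *)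

(* Defs.v *)
From HB Require Import structures.
From mathcomp Require Import all_boot all_order all_algebra.
From mathcomp Require Import boolp classical_sets reals.

Set Implicit Arguments.
Unset Strict Implicit.
Unset Printing Implicit Defensive.

Import Order.TTheory GRing.Theory Num.Theory.
Local Open Scope ring_scope.

(* A simple graph on V is given by its edge set E : {set {set V}}, whose
   members are two-element sets of vertices. *)
Section Graphs.
Variable V : finType.
Implicit Types (E H S T : {set {set V}}) (x y : V).

Definition simple_graph E : Prop := forall e, e \in E -> #|e| = 2%N.

Definition adj H : rel V := [rel x y | [set x; y]%SET \in H].

Definition acyclic H : Prop :=
  forall p : seq V, (2 < size p)%N -> ~~ ucycleb (adj H) p.

(* Lengths of the simple paths from x to y in (V, H). *)
Definition path_length H x y : pred nat := fun n =>
  [exists p : n.-tuple V,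
     [&& path (adj H) x p, last x p == y & uniq (x :: p)]].

(* The value 0 on vertices not joined by a path is a junk value. *)
Definition dist H x y : nat :=
  if pselect (exists n, path_length H x y n) is left xy_joined
  then ex_minn xy_joined else 0%N.

End Graphs.

Definition induced (N : finType) (A : {set N}) (r : rel N) : rel N :=
  [rel x y | [&& x \in A, y \in A & r x y]].

(* Connectedness of the graph with node set A induced by a symmetric r; the
   graph with no node is not connected. *)
Definition connected (N : finType) (A : {set N}) (r : rel N) : Prop :=
  A != finset.set0 /\ {in A &, forall x y, connect (induced A r) x y}.

Section SpanningTrees.
Variable V : finType.
Implicit Types (E H S T : {set {set V}}).

Definition connected_graph H : Prop := connected [set: V]%SET (adj H).

Definition spanning_tree E T : Prop :=
  [/\ T \subset E, connected_graph T & acyclic T].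

Definition spanning_trees E : {set {set {set V}}} :=
  [set T : {set {set V}} | `[< spanning_tree E T >]]%SET.

Definition exchange E : rel {set {set V}} := fun S T =>
  (S != T) &&
  [exists f in E :\: T, [exists e in T, S == (T :|: [set f]) :\ e]]%SET.

End SpanningTrees.

Section Wasserstein.
Variables (R : realType) (V : finType).
Implicit Types (mu nu : V -> R) (pi : V -> V -> R).

Definition prob_density mu : Prop :=
  (forall x, 0 <= mu x) /\ \sum_x mu x = 1.

Definition coupling mu nu pi : Prop :=
  [/\ forall x y, 0 <= pi x y,
      forall x, \sum_y pi x y = mu x &
      forall y, \sum_x pi x y = nu y].

Definition transport_cost (H : {set {set V}}) pi : R :=
  \sum_x \sum_y pi x y * (dist H x y)%:R.

Definition wasserstein (H : {set {set V}}) mu nu : R :=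
  inf [set transport_cost H pi | pi in [set pi | coupling mu nu pi]]%classic.

Definition optimal_trees (E : {set {set V}}) mu nu : {set {set {set V}}} :=
  [set T in spanning_trees E | wasserstein T mu nu == wasserstein E mu nu]%SET.

End Wasserstein.

(* Main.v *)
Require Import Defs.
From HB Require Import structures.
From mathcomp Require Import all_boot all_order all_algebra.
From mathcomp Require Import boolp classical_sets reals.
From mathcomp Require Import fintype finset.
From mathcomp Require Import ring lra.

(** Transporting mu to nu on a connected graph amounts to routing a flow with
    boundary mu - nu along its edges: a coupling becomes a flow when its mass
    is pushed along geodesics ([coupling_flow]), and the l1 norm of that
    flow does not exceed the transport cost.  On a tree T the flow x_T is
    unique, so W_T is the l1 norm of x_T ([wasserstein_tree]); the converse
    bound peels the flow off edge by edge, starting at a vertex without inflow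
    ([flow_coupling]).  On the whole graph the infimum over flows is attained
    at some tree, so W_G is the minimum of the norms |x_T| over spanning trees
    ([wasserstein_graph]).  Hence the trees with W_T = W_G are the spanning
    trees that minimize |x_T|: the optimal bases of a linear program.

    Spanning trees are the bases of the matroid of circulations of the graph
    ([tree_basis], [basis_tree]), and the rest of the argument is linear
    programming over an arbitrary matrix, with weighted l1 norms as objectives.
    Two facts carry it.

    - Bases with the same basic flow are joined by exchanges through bases
      with that flow ([connect_same_flow]): the edges being dropped carry no
      flow.

    - If the basic flow of S does not minimize a weighted norm, then some
      basis with the same flow has an exchange neighbour of strictly smaller
      norm ([pivot]).  Among the circulations along which the norm decreases
      to first order, take one with as few edges as possible outside the
      support of the flow; adding these edges to the support creates only one
      circuit, and one moves along it until an edge of the support is emptied.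
      Changing bases freely within the class of one flow is what makes
      degenerate pivots harmless.

    Given optimal bases S and T, weigh the edges outside T by 1 + eps instead
    of 1.  For small eps, every basis of weighted norm at most that of x_S is
    optimal, because the finitely many non-optimal bases are worse by a fixed
    gap ([optimal_gap]).  The descent from S thus stays among
    optimal bases, and it stops at a flow that avoids every edge outside T,
    which is x_T ([optimal_bases_connected]). *)
Set Implicit Arguments.
Unset Strict Implicit.
Unset Printing Implicit Defensive.

Import Order.TTheory GRing.Theory Num.Theory.
Local Open Scope ring_scope.
Local Open Scope set_scope.

(** * Bases of a matrix and their exchanges *)
Section Bases.
Variables (R : realFieldType) (I K : finType) (M : I -> K -> R).
Implicit Types (B E S T : {set I}) (z c : I -> R) (e f : I) (v : K).

Definition boundary z v : R := \sum_e z e * M e v.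

Definition supp z : {set I} := [set e | z e != 0].

Definition circulation z : Prop := boundary z =1 (fun=> 0).

Definition indep B : Prop :=
  forall z, circulation z -> supp z \subset B -> z =1 (fun=> 0).

Definition basis E B : Prop :=
  [/\ B \subset E, indep B &
      forall f, f \in E :\: B ->
        exists c, [/\ circulation c, supp c \subset f |: B & c f != 0]].

Lemma supp_sub0 B z e : supp z \subset B -> e \notin B -> z e = 0.
Proof.
by move=> /subsetP sB; apply: contraNeq => ze; apply: sB; rewrite inE.
Qed.

Lemma suppS B z : (forall e, e \notin B -> z e = 0) -> supp z \subset B.
Proof.
by move=> zB; apply/subsetP => e; rewrite inE; apply: contraR => /zB ->.
Qed.

Lemma boundary_lin (a : R) z c v :
  boundary (fun e => z e + a * c e) v = boundary z v + a * boundary c v.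
Proof.
rewrite /boundary mulr_sumr -big_split /=; apply: eq_bigr => e _.
by rewrite mulrDl mulrA.
Qed.

Lemma circulation_lin (a : R) z c : circulation z -> circulation c ->
  circulation (fun e => z e + a * c e).
Proof. by move=> z0 c0 v; rewrite boundary_lin z0 c0 mulr0 addr0. Qed.

Lemma basis_sub E B : basis E B -> B \subset E. Proof. by case. Qed.

Lemma flow_uniq B z c : indep B -> boundary z =1 boundary c ->
  supp z \subset B -> supp c \subset B -> z =1 c.
Proof.
move=> iB zc sz sc e; apply/eqP; rewrite -subr_eq0 -mulN1r; apply/eqP.
apply: (iB (fun e => z e + -1 * c e)) => [v|].
  by rewrite boundary_lin zc mulN1r subrr.
by apply: suppS => f fB; rewrite !(supp_sub0 _ fB) // mulr0 addr0.
Qed.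

(** An independent set that is maximal within E spans E: enlarging it by f
    creates a circulation, which must use f. *)
Lemma basis_extend E B : indep B -> B \subset E ->
  exists2 T, basis E T & B \subset T.
Proof.
move=> iB BE.
pose P T := (T \subset E) && `[< indep T >].
have /maxset_exists[T] : P B by rewrite /P BE; apply/asboolP.
move=> /maxsetP[/andP[TE /asboolP iT] maxT] BT; exists T => //; split=> //.
move=> f /setDP[fE fT].
have : ~ indep (f |: T).
  move=> ifT; have := maxT (f |: T); rewrite /P subUset sub1set fE TE subsetUr.
  move=> /(_ (introT andP (conj isT (introT (asboolP _) ifT))) isT) fTT.
  by move: fT; rewrite -fTT setU11.
move=> /existsNP[c /not_implyP[cc /not_implyP[sc c0]]]; exists c; split=> //.
apply/eqP => cf; apply: c0; apply: iT => //; apply: suppS => e eT.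
have [->//|ef] := eqVneq e f.
by apply: (supp_sub0 sc); rewrite !inE negb_or ef.
Qed.

(** Every circulation on B + f is a multiple of c, so that removing an edge e
    with [c e != 0] leaves an independent set; circulations through e are
    cleared of e by subtracting a multiple of c. *)
Lemma basis_exchange E B c e f : basis E B -> f \in E :\: B -> e \in B ->
  circulation c -> supp c \subset f |: B -> c e != 0 ->
  basis E ((B :|: [set f]) :\ e).
Proof.
move=> [BE iB spB] /setDP[fE fB] eB cc sc ce.
have ef : e != f by apply: contraNneq fB => <-.
have cf : c f != 0.
  apply: contraNneq ce => cf; apply/eqP; apply: iB => //; apply: suppS => g gB.
  have [->//|gf] := eqVneq g f.
  by apply: (supp_sub0 sc); rewrite !inE negb_or gf.
split.
- rewrite subDset; apply: (subset_trans _ (subsetUr _ _)).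
  by rewrite subUset BE sub1set.
- move=> d dc sd.
  have dE : (fun g => d g + - (d f / c f) * c g) =1 (fun=> 0).
    apply: iB; first exact: circulation_lin.
    apply: suppS => g gB; have [->|gf] := eqVneq g f; first by field.
    rewrite (supp_sub0 (e := g) sd) ?(supp_sub0 (e := g) sc) ?mulr0 ?addr0 //.
      by rewrite !inE negb_or gf.
    by rewrite !inE negb_and !negb_or gf gB orbT.
  have df : d f = 0.
    have /eqP := dE e; rewrite (supp_sub0 sd) ?inE ?eqxx // add0r.
    rewrite mulf_eq0 (negPf ce) orbF oppr_eq0 mulf_eq0 invr_eq0 (negPf cf).
    by rewrite orbF => /eqP.
  by move=> g; have := dE g; rewrite df mul0r oppr0 mul0r addr0.
- move=> g; rewrite !inE.
  rewrite negb_and negbK negb_or => /andP[/orP[/eqP->|]] => [_|].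
    exists c; split=> //; apply: (subset_trans sc); apply/subsetP => h.
    by rewrite !inE; case: (h == e); rewrite //= orbC.
  move=> /andP[gB gf] gE.
  have /spB[d [dc sd dg]] : g \in E :\: B by rewrite inE gB.
  exists (fun h => d h + - (d e / c e) * c h); split.
  + exact: circulation_lin.
  + apply: suppS => h; rewrite !inE !negb_or negb_and negbK negb_or.
    move=> /andP[hg /orP[/eqP->|/andP[hB hf]]]; first by field.
    rewrite (supp_sub0 (e := h) sd) ?(supp_sub0 (e := h) sc) ?mulr0 ?addr0 //.
      by rewrite !inE negb_or hf.
    by rewrite !inE negb_or hg.
  + rewrite (supp_sub0 (e := g) sc) ?mulr0 ?addr0 //.
    by rewrite !inE negb_or gf.
Qed.

(** * Descent along circuits for weighted norms *)
Definition wnorm (w : I -> R) z : R := \sum_e w e * `|z e|.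

(** The one-sided derivative at z of the weighted norm in the direction c:
    linear in c on the support of z, and a norm off it. *)
Definition slope (w : I -> R) z c : R :=
  \sum_e w e * (if z e == 0 then `|c e| else Num.sg (z e) * c e).

(** Convexity: the difference quotient dominates the derivative. *)
Lemma slope_le w z c : (forall e, 0 <= w e) ->
  slope w z c <= wnorm w (fun e => z e + c e) - wnorm w z.
Proof.
move=> w0; rewrite /slope /wnorm -sumrB; apply: ler_sum => e _.
rewrite -mulrBr; apply: ler_wpM2l => //.
case: eqVneq => [->|ze]; first by rewrite add0r normr0 subr0.
rewrite lerBrDr (normrEsg (z e)) -mulrDr addrC.
apply: le_trans (ler_norm _) _; rewrite normrM normr_sg ze mul1r //.
Qed.

Lemma sg_mul_ge0 (a b : R) : a != 0 -> 0 <= a * b -> 0 <= Num.sg a * b.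
Proof.
move=> a0; rewrite -(@pmulr_rge0 _ `|a|) ?normr_gt0 //.
by rewrite mulrA [`|a| * _]mulrC -numEsg.
Qed.

Section Pivot.
Variables (E B : {set I}) (w z : I -> R).
Hypotheses (w0 : forall e, 0 <= w e) (bB : basis E B) (zB : supp z \subset B).

(** Choose a descent direction c with as few edges as possible off the support
    of z.  Were there a circulation d on [supp z :|: supp c] not proportional
    to c, a multiple of c could be subtracted from d to make the linear form
    psi, which agrees with the slope while the signs of c persist, vanish on
    it; moving c along the result keeps psi, hence the slope, until an edge of
    c off [supp z] disappears, against minimality. *)
Lemma tight_descent c0 : circulation c0 -> supp c0 \subset E ->
    slope w z c0 < 0 ->
  exists c, [/\ circulation c, supp c \subset E, slope w z c < 0 &
    forall d, circulation d -> supp d \subset supp z :|: supp c ->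
      exists a, forall e, d e = a * c e].
Proof.
have [_ iB _] := bB.
move=> cc0 sc0 slc0.
pose P n := exists c, [/\ circulation c, supp c \subset E, slope w z c < 0 &
  #|supp c :\: supp z| = n].
have /ex_minnP[n /asboolP[c [cc sc slc <-]] minn] : exists n, `[< P n >].
  by exists #|supp c0 :\: supp z|; apply/asboolP; exists c0.
exists c; split=> // d dc sd.
pose s e := if z e == 0 then Num.sg (c e) else Num.sg (z e).
pose psi d := \sum_e w e * s e * d e.
have psi_lin a x y : psi (fun e => x e + a * y e) = psi x + a * psi y.
  rewrite /psi mulr_sumr -big_split /=; apply: eq_bigr => e _.
  by rewrite mulrDr; congr (_ + _); rewrite mulrCA.
have slopeE x : (forall e, z e = 0 -> Num.sg (c e) * x e = `|x e|) ->
    slope w z x = psi x.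
  move=> xs; apply: eq_bigr => e _; rewrite /s -mulrA; congr (_ * _).
  by case: eqVneq => // /xs.
have psic : psi c < 0.
  by rewrite -slopeE // => e _; rewrite -normrEsg.
pose d' e := d e + - (psi d / psi c) * c e.
have psid' : psi d' = 0.
  by rewrite psi_lin; field; rewrite lt_eqF.
have cd' : circulation d' by apply: circulation_lin.
have sd' e : z e = 0 -> c e = 0 -> d' e = 0.
  move=> ze ce; rewrite /d' ce (supp_sub0 sd) ?mulr0 ?addr0 //.
  by rewrite !inE ze ce eqxx.
exists (psi d / psi c) => e; apply/eqP; rewrite -subr_eq0 -mulNr.
rewrite -[_ + _]/(d' e); apply/eqP; move: e.
apply: iB => //; apply: contraT => /subsetPn[e1]; rewrite inE => d'e1 e1B.
have ze1 : z e1 = 0 by apply: supp_sub0 zB e1B.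
pose Q e := (z e == 0) && (d' e != 0).
have Qe1 : Q e1 by rewrite /Q ze1 eqxx.
(* The least ratio keeps every sign of c off the support of z. *)
have [e2 /andP[/eqP ze2 d'e2] mine2] :=
  arg_minP (fun e => `|c e / d' e|) Qe1.
pose t := c e2 / d' e2.
pose c2 e := c e + - t * d' e.
suff /minn : `[< P #|supp c2 :\: supp z| >].
  rewrite leqNgt => /negP[]; apply: proper_card.
  apply/properP; split.
    apply/subsetP => e; rewrite !inE => /andP[/negPn/eqP ze].
    rewrite ze eqxx /=; apply: contra_neq => ce.
    by rewrite /c2 ce sd' // mulr0 addr0.
  exists e2; rewrite !inE ze2 eqxx /=; last first.
    by rewrite negbK /c2 /t mulNr divfK // subrr.
  by apply: contra_neq d'e2; apply: sd'.
apply/asboolP; exists c2; split=> //.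
- exact: circulation_lin.
- apply: suppS => e eE.
  have ze : z e = 0.
    by apply: supp_sub0 zB _; apply: contra eE; apply: subsetP e; case: bB.
  have ce := supp_sub0 sc eE.
  by rewrite /c2 ce sd' // mulr0 addr0.
- rewrite slopeE => [|e ze].
    by rewrite psi_lin psid' mulr0 addr0.
  have [ce|ce] := eqVneq (c e) 0.
    by rewrite /c2 ce sd' // mulr0 addr0 sgr0 mul0r normr0.
  suff : 0 <= Num.sg (c e) * c2 e.
    by move=> /ger0_norm <-; rewrite normrM normr_sg ce mul1r.
  rewrite /c2 mulrDr -normrEsg mulNr mulrN subr_ge0.
  apply: le_trans (ler_norm _) _; rewrite normrM (normrM t) normr_sg ce mul1r.
  have [->|d'e] := eqVneq (d' e) 0; first by rewrite normr0 mulr0.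
  have := mine2 e; rewrite /Q ze eqxx d'e => /(_ isT).
  by rewrite -/t [`|c e / _|]normf_div ler_pdivlMr ?normr_gt0.
Qed.

(** One simplex step with a free change of basis.  The tight descent direction
    c spans the circulations on [U := supp z :|: supp c].  Omitting from U an
    edge f of c outside [supp z] leaves an independent set, which extends to a
    basis S carrying z.  Following c as far as no edge of [supp z] changes sign
    empties an edge e of c, so the new flow x lives on S + f - e. *)
Lemma pivot y : boundary y =1 boundary z -> supp y \subset E ->
    wnorm w y < wnorm w z ->
  exists S f e x, [/\ basis E S, supp z \subset S, f \in E :\: S & e \in S] /\
    [/\ basis E ((S :|: [set f]) :\ e), boundary x =1 boundary z,
        supp x \subset (S :|: [set f]) :\ e & wnorm w x < wnorm w z].
Proof.
have [BE iB _] := bB; have zE := subset_trans zB BE.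
move=> yz yE lt_yz.
have [c [cc sc slc only_c]] : exists c, [/\ circulation c, supp c \subset E,
    slope w z c < 0 & forall d, circulation d ->
      supp d \subset supp z :|: supp c -> exists a, forall e, d e = a * c e].
  apply: (@tight_descent (fun e => y e + -1 * z e)).
  - by move=> v; rewrite boundary_lin yz mulN1r subrr.
  - by apply: suppS => e eE; rewrite !(supp_sub0 _ eE) // mulr0 addr0.
  - apply: le_lt_trans (slope_le _ _ w0) _; rewrite subr_lt0.
    apply: le_lt_trans lt_yz; rewrite /wnorm ler_sum // => e _.
    by rewrite mulN1r addrC subrK.
have iBz : indep (supp z) by move=> d dc /subset_trans/(_ zB); apply: iB.
have [f] : exists f, f \in supp c :\: supp z.
  apply/set0Pn; rewrite setD_eq0; apply/negP => cz.
  move: slc; rewrite /slope big1 ?ltxx // => e _; rewrite (iBz c) // mulr0.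
  by rewrite normr0 if_same mulr0.
rewrite !inE negbK => /andP[/eqP zf cf].
have [e1 ze1] : exists e, z e * c e < 0.
  apply: contrapT => /forallNP pos; move: slc; apply/negP; rewrite -leNgt.
  apply: sumr_ge0 => e _; apply: mulr_ge0 => //; case: eqVneq => // ze.
  by apply: sg_mul_ge0 => //; rewrite leNgt; apply/negP/pos.
(* e is the first edge to be emptied, and lam the length of the step. *)
have [e /= ze le_e] := arg_minP (fun e => `|z e / c e|)
  (ze1 : [pred e | z e * c e < 0] e1).
have ce : c e != 0 by apply: contraTneq ze => ->; rewrite mulr0 ltxx.
have zne : z e != 0 by apply: contraTneq ze => ->; rewrite mul0r ltxx.
pose lam := `|z e / c e|.
have lam0 : 0 < lam by rewrite normr_gt0 mulf_neq0 ?invr_eq0.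
have lamE : lam = - (z e / c e).
  rewrite /lam ltr0_norm //.
  have -> : z e / c e = z e * c e * (c e)^-2 by field.
  by rewrite nmulr_rlt0 // invr_gt0 exprn_even_gt0.
pose x g := z g + lam * c g.
have xE : wnorm w x = wnorm w z + lam * slope w z c.
  rewrite /wnorm mulr_sumr -big_split /=; apply: eq_bigr => g _.
  rewrite mulrCA -mulrDr; congr (_ * _); rewrite /x.
  case: eqVneq => [->|zg].
    by rewrite add0r normr0 add0r normrM gtr0_norm.
  suff : 0 <= Num.sg (z g) * (z g + lam * c g).
    move/ger0_norm; rewrite normrM normr_sg zg mul1r => ->.
    by rewrite mulrDr -normrEsg; congr (_ + _); rewrite mulrCA.
  rewrite mulrDr -normrEsg mulrCA.
  have [zc|zc] := ltP (z g * c g) 0.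
    have cg : c g != 0 by apply: contraTneq zc => ->; rewrite mulr0 ltxx.
    have := le_e g zc; rewrite -/lam normf_div ler_pdivlMr ?normr_gt0 // => le.
    rewrite -lerBlDr sub0r; apply: le_trans le.
    rewrite -mulrN ler_pM2l //.
    by apply: le_trans (ler_norm _) _; rewrite normrN normrM normr_sg zg mul1r.
  apply: addr_ge0 => //; apply: mulr_ge0; first exact: ltW.
  exact: sg_mul_ge0.
have xe : x e = 0 by rewrite /x lamE; field.
have ez : e \in supp z by rewrite inE.
have zf' : f \notin supp z by rewrite inE zf eqxx.
have cU d : circulation d -> supp d \subset supp z :|: supp c ->
    d f = 0 -> d =1 (fun=> 0).
  move=> dc /(only_c _ dc)[a da] df g; rewrite da; have := da f; rewrite df.
  by move/esym/eqP; rewrite mulf_eq0 (negPf cf) orbF => /eqP->; rewrite mul0r.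
have [S bS] : exists2 S, basis E S & (supp z :|: supp c) :\ f \subset S.
  apply: basis_extend => [d dc sd|].
    apply: cU => //; first exact: subset_trans sd (subD1set _ _).
    by rewrite (supp_sub0 sd) // !inE eqxx.
  by apply: subset_trans (subD1set _ _) _; rewrite subUset zE.
move=> /subsetP US.
have zS : supp z \subset S.
  apply/subsetP => g gz; apply: US; rewrite !inE (contraNneq _ zf') => [|<-] //.
  by move: gz; rewrite inE => ->.
have cS : supp c \subset f |: S.
  apply/subsetP => g gc; rewrite in_setU1; case: eqVneq => //= gf.
  by apply: US; rewrite in_setD1 gf in_setU gc orbT.
have fE : f \in E by apply: (subsetP sc); rewrite inE.
have fS : f \notin S.
  apply: contraNN cf => fS; have [_ iS _] := bS; apply/eqP.
  by apply: iS => //; apply: subset_trans cS _; rewrite subUset sub1set fS /=.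
have fES : f \in E :\: S by rewrite inE fS.
have eS := subsetP zS _ ez.
exists S, f, e, x; split=> //; split.
- exact: basis_exchange bS fES eS cc cS ce.
- by move=> v; rewrite boundary_lin cc mulr0 addr0.
- apply: suppS => g; rewrite !inE negb_and negbK => /orP[/eqP->//|].
  rewrite negb_or => /andP[gS gf].
  rewrite /x (supp_sub0 zS gS) (supp_sub0 cS) ?mulr0 ?addr0 //.
  by rewrite !inE negb_or gf.
- by rewrite xE gtrDl pmulr_rlt0.
Qed.

End Pivot.
End Bases.

(** * Optimal bases are connected by exchanges *)
Section OptimalBases.
Variables (R : realFieldType) (I K : finType) (M : I -> K -> R).
(* x B will be the basic flow of B, the only flow carried by the basis B. *)
Variables (E : {set I}) (b : K -> R) (x : {set I} -> I -> R).
Implicit Types (A : {set {set I}}) (S T B : {set I}) (w y : I -> R).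

Definition flow B y : Prop := boundary M y =1 b /\ supp y \subset B.

Hypothesis x_flow : forall B, basis M E B -> flow B (x B).

(** On the ground set [{set V}] this is the relation [exchange E]. *)
Definition swap : rel {set I} := fun S T =>
  (S != T) &&
  [exists f in E :\: T, [exists e in T, S == (T :|: [set f]) :\ e]].

Lemma swapP S f e : S \subset E -> f \in E :\: S -> e \in S ->
  swap S ((S :|: [set f]) :\ e).
Proof.
move=> SE /setDP[fE fS] eS; have ef : e != f by apply: contraNneq fS => <-.
apply/andP; split.
  by apply: contraTneq eS => ->; rewrite !inE eqxx.
apply/existsP; exists e; rewrite !inE eqxx (subsetP SE) //=.
apply/existsP; exists f; rewrite !inE eqxx orbT eq_sym ef /=.
apply/eqP/setP => g; rewrite !inE.
have [->|gf] := eqVneq g f; first by rewrite (negPf fS).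
by case: eqVneq => [->|]; rewrite ?eS ?orbF.
Qed.

Lemma basis_antichain S T : basis M E S -> basis M E T -> T \subset S -> T = S.
Proof.
move=> [SE iS _] [TE _ spT] TS; apply/eqP; rewrite eqEsubset TS /=.
apply/subsetP => f fS; apply: contraT => fT.
have /spT[c [cc sc]] : f \in E :\: T by rewrite inE fT (subsetP SE).
rewrite iS ?eqxx //; apply: subset_trans sc _.
by rewrite subUset sub1set fS.
Qed.

Lemma basic_flowE B y : basis M E B -> boundary M y =1 b -> supp y \subset B ->
  x B =1 y.
Proof.
move=> bB yb yB; have [xb xB] := x_flow bB; have [_ iB _] := bB.
by apply: (flow_uniq iB) => // v; rewrite xb yb.
Qed.

Lemma eq_supp (y z : I -> R) : y =1 z -> supp y = supp z.
Proof. by move=> yz; apply/setP => e; rewrite !inE yz. Qed.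

Lemma eq_wnorm w y z : y =1 z -> wnorm w y = wnorm w z.
Proof. by move=> yz; apply: eq_bigr => e _; rewrite yz. Qed.

Lemma connect_step A S T : S \in A -> T \in A -> swap S T ->
  connect (induced A swap) S T.
Proof. by move=> SA TA ST; apply: connect1; rewrite /induced /= SA TA. Qed.

(** Bring in an edge f of T and drop an edge e outside T from the circuit it
    closes: e carries no flow because the common flow lives on T, so the flow
    is unchanged while S gets closer to T. *)
Lemma connect_same_flow A S T : basis M E S -> basis M E T -> x S =1 x T ->
    (forall B, basis M E B -> x B =1 x T -> B \in A) ->
  connect (induced A swap) S T.
Proof.
move=> + bT + xA; move: {2}_.+1 (ltnSn #|T :\: S|) => n.
elim: n => // n IHn in S * => leTn bS xST.
have [/eqP|[f /setDP[fT fS]]] := set_0Vmem (T :\: S).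
  by rewrite setD_eq0 => /(basis_antichain bS bT)->.
have [TE iT _] := bT; have [SE iS spS] := bS.
have fES : f \in E :\: S by rewrite inE fS (subsetP TE).
have [c [cc sc cf]] := spS f fES.
have [e ec eT] : exists2 e, e \in supp c & e \notin T.
  by apply/subsetPn; apply: contra cf => /(iT _ cc)->.
have eS : e \in S.
  have := subsetP sc e ec; rewrite in_setU1 => /orP[/eqP ef|//].
  by rewrite ef fT in eT.
have ce : c e != 0 by rewrite inE in ec.
set S' := (S :|: [set f]) :\ e.
have bS' : basis M E S' := basis_exchange bS fES eS cc sc ce.
have [xSb xSS] := x_flow bS; have [xTb xTT] := x_flow bT.
have xS' : x S' =1 x T.
  apply: basic_flowE => //; apply/subsetP => g gx; rewrite !inE.
  rewrite (contraTneq _ (subsetP xTT g gx)) => [|->] //=.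
  by rewrite (subsetP xSS) // (eq_supp xST).
apply: (@connect_trans _ _ S').
  by apply: connect_step; [exact: xA|exact: xA|exact: swapP].
apply: IHn => //; rewrite ltnS in leTn; apply: leq_trans leTn.
apply: proper_card; apply/properP; split.
  apply/subsetP => g; rewrite !inE => /andP[gS' gT]; rewrite gT andbT.
  apply: contra gS' => gS; rewrite gS /= andbT.
  by apply: contraTneq gT => ->.
exists f; first by rewrite inE fS.
by rewrite !inE eqxx orbT andbT fT andbT negbK (contraTneq _ fT) // => ->.
Qed.

(** Pivoting terminates since the norm decreases strictly and there are
    finitely many bases.  All bases on the way have norm at most that of S. *)
Lemma descend w A S : (forall e, 0 <= w e) -> basis M E S ->
    (forall B, basis M E B -> wnorm w (x B) <= wnorm w (x S) -> B \in A) ->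
  exists T, [/\ basis M E T, connect (induced A swap) S T &
    forall y, flow E y -> wnorm w (x T) <= wnorm w y].
Proof.
move=> w0.
pose below S := [set B | `[< basis M E B >] && (wnorm w (x B) < wnorm w (x S))].
move: {2}_.+1 (ltnSn #|below S|) => n.
elim: n => // n IHn in S * => leSn bS xA.
have [[y [yb yE] lty]|opt] :=
  pselect (exists2 y, flow E y & wnorm w y < wnorm w (x S)); last first.
  exists S; split=> // y fy; rewrite leNgt; apply/negP => lty.
  by apply: opt; exists y.
have [xSb xSS] := x_flow bS.
have yx : boundary M y =1 boundary M (x S) by move=> v; rewrite yb xSb.
have [S1 [f [e [z [[bS1 xS1 fE eS1] [bT zx zT ltz]]]]]] :=
  pivot w0 bS xSS yx yE lty.
set T := _ :\ e in bT zT.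
have xS1S : x S1 =1 x S by apply: basic_flowE.
have xTz : x T =1 z by apply: basic_flowE => // v; rewrite zx.
have ltT : wnorm w (x T) < wnorm w (x S) by rewrite (eq_wnorm _ xTz).
have [||U [bU cU optU]] := IHn T _ bT.
- rewrite ltnS in leSn; apply: leq_trans leSn; apply: proper_card.
  apply/properP; split.
    apply/subsetP => B; rewrite !inE => /andP[-> /lt_trans->] //.
  by exists T; rewrite inE ?ltxx ?andbF // ltT andbT; apply/asboolP.
- by move=> B bB leB; apply: xA => //; apply: le_trans leB (ltW ltT).
exists U; split=> //; apply: connect_trans cU.
apply: (@connect_trans _ _ S1).
  apply: connect_same_flow => // B bB xB.
  by apply: xA => //; rewrite (eq_wnorm _ xB) (eq_wnorm _ xS1S).
apply: connect_step; last by apply: swapP => //; case: bS1.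
  by apply: xA => //; rewrite (eq_wnorm _ xS1S).
by apply: xA => //; apply: ltW.
Qed.

Definition norm1 y : R := wnorm (fun=> 1) y.

Definition optimal_basis B : Prop :=
  basis M E B /\ forall y, flow E y -> norm1 (x B) <= norm1 y.

Lemma optimal_basis_exists S : basis M E S -> exists T, optimal_basis T.
Proof.
move=> bS; have [||T [bT _ optT]] := @descend (fun=> 1) [set: {set I}] S _ bS.
- by move=> _; apply: ler01.
- by move=> B _ _; rewrite inE.
by exists T.
Qed.

Lemma optimal_gap S : optimal_basis S -> exists2 d : R, 0 < d &
  forall B, basis M E B -> norm1 (x B) < norm1 (x S) + d -> optimal_basis B.
Proof.
move=> [bS optS].
pose bad B := `[< basis M E B /\ ~ optimal_basis B >].
exists (\big[Num.min/1]_(B | bad B) (norm1 (x B) - norm1 (x S))).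
  apply: lt_bigmin => // B /asboolP[bB nopt]; rewrite subr_gt0 ltNge.
  apply/negP => leB; apply: nopt; split=> // y fy.
  exact: le_trans leB (optS y fy).
move=> B bB ltB; apply: contrapT => nopt; move: ltB; apply/negP.
rewrite -leNgt -lerBrDl; apply: bigmin_le_cond.
exact/asboolP.
Qed.

(** The weights w single out the basic flow of T among the optimal flows, and
    eps is so small that the descent for w cannot leave the optimal bases. *)
Lemma optimal_bases_connected A S T :
    (forall B, reflect (optimal_basis B) (B \in A)) -> S \in A -> T \in A ->
  connect (induced A swap) S T.
Proof.
move=> AP /AP optS /AP optT.
have [d d0 gap] := optimal_gap optS.
have [bS leS] := optS; have [bT leT] := optT.
have [xTb xTT] := x_flow bT.
pose g y := \sum_(e | e \notin T) `|y e|.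
have g0 y : 0 <= g y by apply: sumr_ge0.
pose eps := d / (1 + g (x S)).
have g1 : 0 < 1 + g (x S) by rewrite ltr_pwDl.
have eps0 : 0 < eps by rewrite divr_gt0.
have epsg : eps * g (x S) < d.
  by rewrite /eps mulrAC ltr_pdivrMr // ltr_pM2l // ltrDr.
pose w e := 1 + eps * (e \notin T)%:R.
have wE y : wnorm w y = norm1 y + eps * g y.
  rewrite /norm1 /wnorm /g mulr_sumr [X in _ + X]big_mkcond -big_split /=.
  apply: eq_bigr => e _; rewrite mulrDl; congr (_ + _).
  by case: ifP => _; rewrite ?mulr1 // mulr0 mul0r.
have [e|B bB|U [bU cU optU]] := @descend w A S _ bS.
- by rewrite addr_ge0 // mulr_ge0 ?ler0n // ltW.
- rewrite !wE => leB; apply/AP/gap => //.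
  apply: (@le_lt_trans _ _ (norm1 (x S) + eps * g (x S))); last first.
    by rewrite ltrD2l.
  by apply: le_trans leB; rewrite lerDl mulr_ge0 // ltW.
apply: connect_trans cU _.
have [xUb xUU] := x_flow bU.
have gU : g (x U) = 0.
  have := optU (x T); rewrite !wE.
  have -> : g (x T) = 0.
    by apply: big1 => e eT; rewrite (supp_sub0 xTT eT) normr0.
  rewrite mulr0 addr0 => /(_ (conj xTb (subset_trans xTT (basis_sub bT)))) le1.
  have le2 := leT (x U) (conj xUb (subset_trans xUU (basis_sub bU))).
  have : eps * g (x U) <= 0.
    by rewrite -(lerD2l (norm1 (x U))) addr0; apply: le_trans le1 le2.
  by rewrite pmulr_rle0 // => le0; apply/eqP; rewrite eq_le le0 g0.
have xUT : supp (x U) \subset T.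
  apply: suppS => e eT; apply/normr0_eq0/eqP; move/eqP: gU.
  by rewrite psumr_eq0 // => /allP/(_ e); rewrite mem_index_enum eT; apply.
have xTU : x T =1 x U by apply: basic_flowE.
apply: connect_same_flow => // B bB xBT; apply/AP; split=> // y fy.
by rewrite /norm1 (eq_wnorm _ xBT); apply: leT.
Qed.

End OptimalBases.

(** * Spanning trees are the bases of the incidence matrix *)
Section Incidence.
Variables (R : realFieldType) (V : finType).
Implicit Types (E H T A : {set {set V}}) (x y v : V) (z c : {set V} -> R).

(** Each edge is oriented out of the endpoint that [pick] returns; nothing
    depends on this choice except the sign with which a flow is recorded.  The
    flow that e carries out of an endpoint x is [z e * incidence e x]. *)
Definition incidence (e : {set V}) v : R :=
  if [pick x in e] is Some x then (v \in e)%:R * (-1) ^+ (v != x) else 0.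

Local Notation M := incidence.

Lemma incidence_edge x y v : x != y ->
  M [set x; y] v = M [set x; y] x * ((v == x)%:R - (v == y)%:R).
Proof.
move=> xy; rewrite /incidence; case: pickP => [u|_]; last by rewrite mul0r.
rewrite !inE eqxx /= mul1r => /orP[] /eqP->.
  have [E|_] := eqVneq v x; first by rewrite E eqxx (negPf xy) /=; ring.
  by case: (v == y); rewrite eqxx /=; ring.
rewrite xy; have [E|_] := eqVneq v x; first by rewrite E (negPf xy) /=; ring.
by case: (v == y); rewrite /=; ring.
Qed.

Lemma incidence_sqr x y : M [set x; y] x * M [set x; y] x = 1.
Proof.
rewrite /incidence; case: pickP => [u _|/(_ x)]; last by rewrite !inE eqxx.
by rewrite !inE eqxx /= mul1r -signr_addb addbb.
Qed.

Lemma norm_incidence x y : `|M [set x; y] x| = 1.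
Proof.
rewrite /incidence; case: pickP => [u _|/(_ x)]; last by rewrite !inE eqxx.
by rewrite !inE eqxx /= mul1r normr_sign.
Qed.

Lemma incidence_neq0 x y : M [set x; y] x != 0.
Proof.
apply/eqP => M0; have := incidence_sqr x y.
by rewrite M0 mul0r => /eqP; rewrite eq_sym oner_eq0.
Qed.

Lemma adjE H x y : adj H x y = ([set x; y] \in H). Proof. by []. Qed.

Lemma adj_neq H x y : simple_graph H -> [set x; y] \in H -> x != y.
Proof. by move=> sH /sH; rewrite cards2; case: eqVneq. Qed.

Lemma edgeP H e : simple_graph H -> e \in H ->
  exists x y, x != y /\ e = [set x; y].
Proof. by move=> sH /sH/eqP/cards2P[x [y [xy ->]]]; exists x, y. Qed.

Lemma simple_graphS E H : H \subset E -> simple_graph E -> simple_graph H.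
Proof. by move=> /subsetP HE sE e /HE/sE. Qed.

Lemma cut_incidence (A : {set V}) x y : x != y ->
  \sum_(v in A) M [set x; y] v =
  M [set x; y] x * ((x \in A)%:R - (y \in A)%:R).
Proof.
move=> xy; under eq_bigr do rewrite incidence_edge //.
have delta u : \sum_(v in A) (v == u)%:R = (u \in A)%:R :> R.
  rewrite big_mkcond (bigD1 u) //= eqxx big1 ?addr0; first by case: ifP.
  by move=> v /negPf->; rewrite if_same.
by rewrite -mulr_sumr sumrB !delta.
Qed.

(** The net flow of a circulation out of A is zero, and the edge from x to y is
    the only one that crosses the boundary of A. *)
Lemma circulation_bridge H (A : {set V}) x y z : simple_graph H -> x != y ->
    (x \in A) != (y \in A) ->
    (forall u v, [set u; v] \in H -> [set u; v] != [set x; y] ->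
       (u \in A) = (v \in A)) ->
    circulation M z -> supp z \subset [set x; y] |: H ->
  z [set x; y] = 0.
Proof.
move=> sH xy xyA AH cz sz.
have /eqP : \sum_(v in A) boundary M z v = 0 by apply: big1 => v _; apply: cz.
rewrite exchange_big /= (bigD1 [set x; y]) //= [X in _ + X]big1 => [|e exy].
  rewrite addr0 -mulr_sumr cut_incidence // !mulf_eq0.
  rewrite (negPf (incidence_neq0 _ _)) /=; move: xyA.
  case: (x \in A); case: (y \in A) => // _; rewrite ?subr0 ?sub0r ?oppr_eq0.
    by rewrite oner_eq0 orbF => /eqP.
  by rewrite oner_eq0 orbF => /eqP.
have [eH|eH] := boolP (e \in H); last first.
  by apply: big1 => v _; rewrite (supp_sub0 sz) ?mul0r // !inE negb_or exy.
have [u [v [uv eE]]] := edgeP sH eH; rewrite {e}eE in eH exy *.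
by rewrite -mulr_sumr cut_incidence // (AH u v) // subrr !mulr0.
Qed.

(** The factor makes this the unit flow from x to y whatever the orientation
    of the edge. *)
Definition edge_flow x y : {set V} -> R :=
  fun e => (e == [set x; y])%:R * M [set x; y] x.

Lemma boundary_edge_flow x y v : x != y ->
  boundary M (edge_flow x y) v = (v == x)%:R - (v == y)%:R.
Proof.
move=> xy; rewrite /boundary (bigD1 [set x; y]) //= big1 => [|e /negPf exy].
  rewrite addr0 /edge_flow eqxx mul1r (incidence_edge v xy).
  by rewrite mulrA incidence_sqr mul1r.
by rewrite /edge_flow exy !mul0r.
Qed.

Lemma supp_edge_flow x y : supp (edge_flow x y) \subset [set [set x; y]].
Proof.
by apply: suppS => e; rewrite inE /edge_flow => /negPf->; rewrite mul0r.
Qed.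

Lemma norm1_edge_flow x y : norm1 (edge_flow x y) = 1.
Proof.
rewrite /norm1 /wnorm (bigD1 [set x; y]) //= big1 => [|e /negPf exy].
  by rewrite /edge_flow eqxx !mul1r addr0 norm_incidence.
by rewrite /edge_flow exy !mul0r normr0 mulr0.
Qed.

Lemma norm1D z c : norm1 (fun e => z e + c e) <= norm1 z + norm1 c.
Proof.
rewrite /norm1 /wnorm -big_split /=; apply: ler_sum => e _.
by rewrite !mul1r ler_normD.
Qed.

Lemma boundaryD z c v :
  boundary M (fun e => z e + c e) v = boundary M z v + boundary M c v.
Proof. by rewrite -big_split; apply: eq_bigr => e _; rewrite mulrDl. Qed.

Lemma path_flow H x p : simple_graph H -> path (adj H) x p ->
  exists z, [/\ flow M (fun v => (v == x)%:R - (v == last x p)%:R) H z &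
    norm1 z <= (size p)%:R].
Proof.
move=> sH; elim: p x => [x _|y p IHp x /= /andP[xy /IHp[z [[bz sz] nz]]]].
  exists (fun=> 0); split; last first.
    by rewrite /norm1 /wnorm big1 // => e _; rewrite normr0 mulr0.
  split=> [v|]; first by rewrite subrr; apply: big1 => e _; rewrite mul0r.
  by apply: suppS.
exists (fun e => edge_flow x y e + z e); split; last first.
  apply: le_trans (norm1D _ _) _.
  by rewrite norm1_edge_flow -add1n natrD lerD2l.
split=> [v|].
  rewrite boundaryD bz boundary_edge_flow; last exact: adj_neq sH xy.
  by rewrite addrA subrK.
apply: suppS => e eH; rewrite (supp_sub0 sz eH) addr0.
apply: supp_sub0 (supp_edge_flow x y) _; rewrite inE.
by apply: contraNneq eH => ->.
Qed.

Lemma connected_graphP H : connected_graph H <->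
  (exists x : V, True) /\ forall x y, connect (adj H) x y.
Proof.
have eqH : connect (induced [set: V] (adj H)) =2 connect (adj H).
  by apply: eq_connect => x y; rewrite /induced /= !inE.
split=> [[/set0Pn[x _] H1]|[[x _] H1]]; split.
- by exists x.
- by move=> u v; rewrite -eqH; apply: H1; rewrite inE.
- by apply/set0Pn; exists x; rewrite inE.
- by move=> u v _ _; rewrite eqH.
Qed.

(** A simple path from x to y avoiding the edge from x to y would close up with
    it to a cycle. *)
Lemma acyclic_bridge T x y : simple_graph T -> acyclic T -> [set x; y] \in T ->
  ~~ connect (adj (T :\ [set x; y])) x y.
Proof.
move=> sT aT xyT; have xy := adj_neq sT xyT.
apply/negP => /connectP[p0 /shortenP[p pp up _] yE] {p0}.
case: p => [|u p] in pp up yE; first by rewrite yE eqxx in xy.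
case: p => [|u' p] in pp up yE.
  by rewrite /= in yE; move: pp; rewrite /= adjE -yE !inE eqxx.
have /negP[] := aT [:: x, u, u' & p] isT.
rewrite /ucycleb up andbT.
rewrite -[cycle _ _]/(path (adj T) x (rcons [:: u, u' & p] x)) rcons_path -yE.
rewrite adjE setUC xyT andbT.
by apply: sub_path pp => a b; rewrite !adjE !inE => /andP[].
Qed.

(** A unit flow along an edge of a cycle, returned along the rest of the cycle,
    is a nonzero circulation. *)
Lemma indep_acyclic T : simple_graph T -> indep M T -> acyclic T.
Proof.
move=> sT iT [|x [|y [|a q]]] // _; apply/negP.
move=> /andP[/= /andP[xy /andP[ya pq]]].
rewrite !inE !negb_or -!andbA => /and5P[nxy nxa xq nya /and3P[yq aq _]].
have : path (adj (T :\ [set x; y])) y (a :: rcons q x).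
  rewrite /= adjE 2!inE -adjE ya andbT; apply/andP; split.
    apply/eqP => /setP/(_ a); rewrite !inE eqxx orbT.
    by rewrite eq_sym (negPf nxa) eq_sym (negPf nya).
  have : all (predC1 y) (a :: rcons q x).
    rewrite /= eq_sym nya all_rcons /= nxy; apply/allP => u uq /=.
    by apply: contraNneq yq => <-.
  move=> ally; apply: (sub_in_path _ ally pq) => u v; rewrite !inE => uy vy uv.
  rewrite adjE 2!inE -adjE uv andbT; apply/eqP => /setP/(_ y).
  rewrite !inE eqxx orbT.
  by rewrite eq_sym (negPf uy) eq_sym (negPf vy).
move=> /path_flow[|z [[bz sz] _]]; first exact: simple_graphS (subD1set _ _) sT.
suff /(_ [set x; y])/eqP : (fun e => edge_flow x y e + z e) =1 (fun=> 0).
  rewrite (supp_sub0 sz) ?inE ?eqxx // addr0 /edge_flow eqxx mul1r.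
  by rewrite (negPf (incidence_neq0 _ _)).
apply: iT => [v|].
  rewrite boundaryD bz /= last_rcons boundary_edge_flow //.
  by rewrite addrA subrK subrr.
apply: suppS => e eT.
rewrite (supp_sub0 sz) ?addr0; last by rewrite inE (negPf eT) andbF.
apply: supp_sub0 (supp_edge_flow x y) _; rewrite inE.
by apply: contraNneq eT => ->.
Qed.

(** Independence: an edge of T is the only edge of T that leaves the component
    of x in T without that edge.  Spanning: an edge outside T closes a circuit
    with the path of T between its endpoints. *)
Lemma tree_basis E T : simple_graph E -> spanning_tree E T -> basis M E T.
Proof.
move=> sE [TE /connected_graphP[_ cT] aT]; have sT := simple_graphS TE sE.
split=> // [z cz sz e|f /setDP[fE fT]].
  have [eT|/(supp_sub0 sz)//] := boolP (e \in T).
  have [x [y [xy eE]]] := edgeP sT eT; rewrite {e}eE in eT *.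
  pose A := [set v | connect (adj (T :\ [set x; y])) x v].
  apply: (circulation_bridge (A := A) sT xy) => //.
  - by rewrite !inE connect0 (negPf (acyclic_bridge sT aT eT)).
  - move=> u v uvT uvxy; rewrite !inE; apply/idP/idP => /connect_trans; apply.
      by apply: connect1; rewrite adjE !inE uvxy.
    by apply: connect1; rewrite adjE setUC !inE uvxy.
  - exact: subset_trans sz (subsetUr _ _).
have [x [y [xy fxy]]] := edgeP sE fE.
have /connectP[p /(path_flow sT)[z [[bz sz] _]] xp] := cT y x.
exists (fun e => edge_flow x y e + z e); split.
- move=> v; rewrite boundaryD bz -xp boundary_edge_flow //.
  by rewrite addrA subrK subrr.
- apply: suppS => e; rewrite inE negb_or fxy => /andP[exy eT].
  by rewrite (supp_sub0 sz) // (supp_sub0 (supp_edge_flow x y)) ?addr0.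
- rewrite (supp_sub0 sz fT) addr0 /edge_flow fxy eqxx mul1r.
  exact: incidence_neq0.
Qed.

(** If T were disconnected, some edge of E would leave a component of T; no
    circulation on T and that edge can use it. *)
Lemma basis_tree E T : simple_graph E -> connected_graph E -> basis M E T ->
  spanning_tree E T.
Proof.
move=> sE /connected_graphP[x0 cE] [TE iT spT]; have sT := simple_graphS TE sE.
split=> //; last exact: indep_acyclic.
apply/connected_graphP; split=> // x y.
pose A := [set v | connect (adj T) x v].
have AT u v : adj T u v -> (u \in A) = (v \in A).
  move=> uv; rewrite !inE; apply/idP/idP => /connect_trans; apply.
    exact: connect1.
  by apply: connect1; rewrite adjE setUC.
suff AE : closed (adj E) (mem A).
  by have := closed_connect AE (cE x y); rewrite !inE connect0 => <-.
move=> u v uvE; apply: contrapT => /eqP uvA.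
have uvT : [set u; v] \notin T by apply: contra uvA => /AT/eqP.
have /spT[c [cc sc]] : [set u; v] \in E :\: T by rewrite inE uvT.
move=> /eqP[]; apply: (circulation_bridge (A := A) sT (adj_neq sE uvE)) => //.
by move=> a a' aT _; apply: AT.
Qed.

(** On a tree every orientation of the edges is a gradient: f v counts, with
    signs, the edges of the path from v to a root r.  The paths from the two
    endpoints of an edge differ by that edge, by uniqueness of flows. *)
Lemma indep_potential T z : simple_graph T -> connected_graph T -> indep M T ->
  exists f : V -> R, forall x y, [set x; y] \in T ->
    0 < z [set x; y] * M [set x; y] x -> f y < f x.
Proof.
move=> sT /connected_graphP[[r _] cT] iT.
have /choice[P Pflow] : forall v, exists c,
    flow M (fun u => (u == v)%:R - (u == r)%:R) T c.
  move=> v; have /connectP[p /(path_flow sT)[c [fc _]] rp] := cT v r.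
  by exists c; rewrite rp.
exists (fun v => \sum_e Num.sg (z e) * P v e) => x y xyT zpos.
have xy := adj_neq sT xyT.
have PE : P x =1 (fun e => edge_flow x y e + P y e).
  have [[bPx sPx] [bPy sPy]] := (Pflow x, Pflow y).
  apply: (flow_uniq iT) => // [v|].
    by rewrite boundaryD bPx bPy boundary_edge_flow // addrA subrK.
  apply: suppS => e eT; rewrite (supp_sub0 sPy eT) addr0.
  apply: supp_sub0 (supp_edge_flow x y) _; rewrite inE.
  by apply: contraNneq eT => ->.
under [X in _ < X]eq_bigr do rewrite PE mulrDr.
rewrite big_split /= ltrDr (bigD1 [set x; y]) //= big1 => [|e /negPf exy].
  rewrite addr0 /edge_flow eqxx mul1r; move: zpos.
  set m := M _ _; have m0 : m != 0 by apply: incidence_neq0.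
  move=> zm; have z0 : z [set x; y] != 0.
    by apply: contraTneq zm => ->; rewrite mul0r ltxx.
  rewrite lt_neqAle eq_sym mulf_neq0 ?sgr_eq0 //=.
  exact/sg_mul_ge0/ltW.
by rewrite /edge_flow exy mul0r mulr0.
Qed.

End Incidence.

(** * Distances *)
Section Distances.
Variable V : finType.
Implicit Types (H T : {set {set V}}) (x y z : V).

Lemma dist_le_size H x p : path (adj H) x p ->
  (dist H x (last x p) <= size p)%N.
Proof.
move=> /shortenP[q qH uq sqp].
have pq : path_length H x (last x q) (size q).
  by apply/existsP; exists (in_tuple q); rewrite qH uq eqxx.
have leq : (size q <= size p)%N.
  by apply: uniq_leq_size => //; case/andP: uq.
rewrite /dist; case: pselect => // ex; case: ex_minnP => n _ minn.
exact: leq_trans (minn _ pq) leq.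
Qed.

Lemma dist_geodesic H x y : connect (adj H) x y ->
  exists p, [/\ path (adj H) x p, last x p = y & size p = dist H x y].
Proof.
move=> /connectP[p0 /shortenP[q qH uq _] yE].
rewrite /dist; case: pselect => [ex|[]]; last first.
  by exists (size q); apply/existsP; exists (in_tuple q); rewrite qH uq yE eqxx.
case: ex_minnP => n /existsP[p /and3P[pH /eqP py _]] _.
by exists p; rewrite size_tuple.
Qed.

Lemma distxx H x : dist H x x = 0%N.
Proof. by apply/eqP; rewrite -leqn0; apply: (@dist_le_size H x [::]). Qed.

Lemma dist_step H x y z : connected_graph H -> adj H x y ->
  (dist H x z <= (dist H y z).+1)%N.
Proof.
move=> /connected_graphP[_ cH] xy.
have [p [pH pz <-]] := dist_geodesic (cH y z).
by rewrite -pz; apply: (@dist_le_size H x (y :: p)); rewrite /= xy.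
Qed.

Lemma dist_anti T H x y : T \subset H -> connected_graph T ->
  (dist H x y <= dist T x y)%N.
Proof.
move=> /subsetP TH /connected_graphP[_ cT].
have [p [pT py <-]] := dist_geodesic (cT x y).
by rewrite -py; apply: dist_le_size; apply: sub_path pT => u v /TH.
Qed.

End Distances.

(** * Transport costs and norms of flows *)
Section Transport.
Variables (R : realType) (V : finType).
Implicit Types (E H T : {set {set V}}) (x y v : V) (z : {set V} -> R).
Implicit Types (mu nu : V -> R) (pi : V -> V -> R).

Local Notation M := (@incidence R V).

(** Push the mass [pi x y] along a geodesic from x to y. *)
Lemma coupling_flow H mu nu pi : simple_graph H -> connected_graph H ->
    coupling mu nu pi ->
  exists2 z, flow M (fun v => mu v - nu v) H z & norm1 z <= transport_cost H pi.
Proof.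
move=> sH /connected_graphP[_ cH] [pi0 pi_mu pi_nu].
have /choice[P Pflow] : forall xy : V * V, exists z,
    flow M (fun v => (v == xy.1)%:R - (v == xy.2)%:R) H z /\
    norm1 z <= (dist H xy.1 xy.2)%:R.
  move=> [x y]; have [p [pH py <-]] := dist_geodesic (cH x y).
  have [z [fz nz]] := path_flow R sH pH.
  by exists z; split=> //=; rewrite -py.
have delta (F : V -> R) v : \sum_x F x * (v == x)%:R = F v.
  rewrite (bigD1 v) //= eqxx mulr1 big1 ?addr0 // => x.
  by rewrite eq_sym => /negPf->; rewrite mulr0.
exists (fun e => \sum_x \sum_y pi x y * P (x, y) e); first split.
- move=> v; rewrite /boundary; under eq_bigr do rewrite mulr_suml.
  rewrite exchange_big /=.
  transitivity (\sum_x \sum_y pi x y * ((v == x)%:R - (v == y)%:R)).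
    apply: eq_bigr => x _; under eq_bigr do rewrite mulr_suml.
    rewrite exchange_big /=; apply: eq_bigr => y _.
    have [[bP _] _] := Pflow (x, y); rewrite -bP mulr_sumr.
    by apply: eq_bigr => e _; rewrite mulrA.
  under eq_bigr => x _ do under eq_bigr => y _ do rewrite mulrBr.
  under eq_bigr => x _ do rewrite sumrB -mulr_suml pi_mu delta.
  by rewrite sumrB delta pi_nu.
- apply: suppS => e eH; apply: big1 => x _; apply: big1 => y _.
  by have [[_ sP] _] := Pflow (x, y); rewrite (supp_sub0 sP eH) mulr0.
- apply: (@le_trans _ _ (\sum_x \sum_y pi x y * norm1 (P (x, y)))); last first.
    apply: ler_sum => x _; apply: ler_sum => y _; apply: ler_wpM2l => //.
    by have [] := Pflow (x, y).
  apply: (@le_trans _ _ (\sum_e \sum_x \sum_y pi x y * `|P (x, y) e|)).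
    apply: ler_sum => e _; rewrite mul1r.
    apply: le_trans (ler_norm_sum _ _ _) _.
    apply: ler_sum => x _; apply: le_trans (ler_norm_sum _ _ _) _.
    by apply: ler_sum => y _; rewrite normrM ger0_norm.
  rewrite exchange_big /=; apply: ler_sum => x _.
  rewrite exchange_big /=; apply: ler_sum => y _.
  by rewrite /norm1 /wnorm mulr_sumr; apply: ler_sum => e _; rewrite mul1r.
Qed.

(** A flow that descends a potential f is realized by a coupling.  Induction
    on the number of edges in use: the vertex x of largest potential among
    those with outflow has no inflow, so its mass is at least the amount a that
    leaves it along an edge to y.  Moving the amount a from x to y leaves a
    flow on fewer edges; in the coupling obtained for it, the fraction a / mu' y
    of the row of y is handed back to x, at an extra cost of at most a. *)
Lemma flow_coupling H mu nu z (f : V -> R) :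
    simple_graph H -> connected_graph H ->
    (forall x y, [set x; y] \in H ->
       0 < z [set x; y] * M [set x; y] x -> f y < f x) ->
    (forall v, 0 <= mu v) -> (forall v, 0 <= nu v) ->
    flow M (fun v => mu v - nu v) H z ->
  exists2 pi, coupling mu nu pi & transport_cost H pi <= norm1 z.
Proof.
move=> sH cH; move: {2}_.+1 (ltnSn #|supp z|) => n.
elim: n => // n IHn in z mu * => lezn fz mu0 nu0 [bz sz].
have [z0|[e ez]] := set_0Vmem (supp z).
  have ze e : z e = 0 by apply: (@supp_sub0 _ _ set0); rewrite ?z0 ?inE.
  have munu v : mu v = nu v.
    apply/eqP; rewrite -subr_eq0 -bz /boundary big1 // => e _.
    by rewrite ze mul0r.
  exists (fun x y => mu x * (x == y)%:R).
    split=> [x y|x|y]; first by rewrite mulr_ge0 ?ler0n.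
      rewrite (bigD1 x) //= eqxx mulr1 big1 ?addr0 // => y.
      by rewrite eq_sym => /negPf->; rewrite mulr0.
    rewrite (bigD1 y) //= eqxx mulr1 big1 ?addr0 // => x.
    by move=> /negPf->; rewrite mulr0.
  rewrite /transport_cost big1 => [|x _].
    by apply: sumr_ge0 => e _; rewrite mul1r.
  apply: big1 => y _.
  by case: eqVneq => [->|_]; rewrite ?distxx ?mulr0 ?mul0r.
have edge_dir x y : x != y -> M [set x; y] y = - M [set x; y] x.
  move=> xy; rewrite (incidence_edge _ y xy) eqxx eq_sym (negPf xy).
  by rewrite sub0r mulrN1.
pose src x :=
  [exists y, ([set x; y] \in H) && (0 < z [set x; y] * M [set x; y] x)].
have [x0 src0] : exists x, src x.
  have eH := subsetP sz e ez.
  have [x [y [xy eE]]] := edgeP sH eH; rewrite {e}eE in ez eH *.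
  have zm : z [set x; y] * M [set x; y] x != 0.
    by rewrite inE in ez; rewrite mulf_neq0 // incidence_neq0.
  have [lt0|gt0|/eqP] := ltgtP (z [set x; y] * M [set x; y] x) 0; last first.
  - by rewrite (negPf zm).
  - by exists x; apply/existsP; exists y; rewrite eH.
  exists y; apply/existsP; exists x.
  by rewrite setUC eH edge_dir // mulrN oppr_gt0.
have [x srcx maxx] := arg_maxP f src0.
have /existsP[y /andP[xyH a0]] := srcx.
have xy := adj_neq sH xyH.
set a := z _ * _ in a0.
(* Inflow at x would come from a vertex of larger potential with outflow. *)
have noin e' : 0 <= z e' * M e' x.
  rewrite leNgt; apply/negP => lt0.
  have e'H : e' \in H.
    by apply: contraTT lt0 => /(supp_sub0 sz)->; rewrite mul0r ltxx.
  have [u [v [uv eE]]] := edgeP sH e'H; rewrite {e'}eE in lt0 e'H.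
  have in_src t t' : t != t' -> [set t; t'] \in H -> x = t ->
      z [set t; t'] * M [set t; t'] x < 0 -> False.
    move=> tt' tH xt; rewrite xt => lt.
    have pos : 0 < z [set t'; t] * M [set t'; t] t'.
      by rewrite setUC edge_dir // mulrN oppr_gt0.
    have tH' : [set t'; t] \in H by rewrite setUC.
    have := fz _ _ tH' pos; apply/negP; rewrite -leNgt -xt; apply: maxx.
    by apply/existsP; exists t; rewrite tH'.
  have [xu|xu] := eqVneq x u; first exact: (in_src u v).
  have [xv|xv] := eqVneq x v.
    by apply: (in_src v u) => //; rewrite 1?eq_sym // setUC.
  move: lt0; rewrite (incidence_edge _ x uv) (negPf xu) (negPf xv) subrr.
  by rewrite !mulr0 ltxx.
have ax : a <= mu x.
  have : mu x - nu x = a + \sum_(e | e != [set x; y]) z e * M e x.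
    by rewrite -bz /boundary (bigD1 [set x; y]).
  have : 0 <= \sum_(e | e != [set x; y]) z e * M e x by apply: sumr_ge0.
  have := nu0 x; lra.
pose mu' v := mu v - a * (v == x)%:R + a * (v == y)%:R.
pose z' e := if e == [set x; y] then 0 else z e.
have mu'y : mu' y = mu y + a.
  by rewrite /mu' eqxx eq_sym (negPf xy) mulr0 subr0 mulr1.
have mu'y0 : 0 < mu' y by rewrite mu'y ltr_wpDl.
have bz' : boundary M z' =1 (fun v => mu' v - nu v).
  move=> v.
  suff -> : boundary M z' v = boundary M z v - z [set x; y] * M [set x; y] v.
    rewrite bz (incidence_edge _ v xy) mulrA -/a /mu'.
    by move: ((v == x)%:R : R) ((v == y)%:R : R) => dx dy; ring.
  rewrite /boundary [in RHS](bigD1 [set x; y]) //= addrAC subrr add0r.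
  rewrite (bigD1 [set x; y]) //= /z' eqxx mul0r add0r.
  by apply: eq_bigr => e' /negPf->.
have [|u v uvH|v|//|//|pi' cpi' cost'] := IHn z' mu'.
- rewrite ltnS in lezn; apply: leq_trans lezn; apply: proper_card.
  apply/properP; split.
    by apply/subsetP => e'; rewrite !inE /z'; case: ifP; rewrite ?eqxx.
  exists [set x; y]; rewrite inE /z' ?eqxx //.
  by apply: contraTneq a0 => z0; rewrite /a z0 mul0r ltxx.
- by rewrite /z'; case: ifP => [_|_ /(fz _ _ uvH)//]; rewrite mul0r ltxx.
- rewrite /mu'; have [->|vx] := eqVneq v x.
    by rewrite (negPf xy) /=; lra.
  by have := mu0 v; case: (v == y) => /=; lra.
- split=> //; apply: suppS => e' e'H; rewrite /z'; case: ifP => // _.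
  exact: supp_sub0 sz e'H.
have [pi'0 pi'mu pi'nu] := cpi'.
pose t := a / mu' y.
have t0 : 0 <= t by rewrite divr_ge0 // ltW.
have t1 : t <= 1 by rewrite ler_pdivrMr // mul1r mu'y lerDr.
have ta : t * mu' y = a by rewrite divfK // gt_eqF.
(* k moves the fraction t of the row of y to the row of x. *)
pose k u : R := (u == x)%:R - (u == y)%:R.
pose pi u v := pi' u v + t * k u * pi' y v.
have sumk (F : V -> R) : \sum_u k u * F u = F x - F y.
  rewrite (bigD1 x) //= (bigD1 y) 1?eq_sym //= big1 => [|u /andP[ux uy]].
    by rewrite /k !eqxx (negPf xy) eq_sym (negPf xy) /=; ring.
  by rewrite /k (negPf ux) (negPf uy) subrr mul0r.
exists pi.
  split=> [u v|u|v].
  - rewrite /pi /k; have [->|ux] := eqVneq u x.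
      by rewrite (negPf xy) subr0 mulr1 addr_ge0 // mulr_ge0.
    have [->|uy] := eqVneq u y; last by rewrite subrr mulr0 mul0r addr0.
    rewrite [X in 0 <= X](_ : _ = (1 - t) * pi' y v) /=; last by ring.
    by rewrite mulr_ge0 // subr_ge0.
  - rewrite /pi big_split /= pi'mu -mulr_sumr pi'mu mulrAC ta /mu' /k; ring.
  - rewrite /pi big_split /= pi'nu.
    under [X in _ + X]eq_bigr do rewrite -mulrA [k _ * _]mulrC mulrA.
    under [X in _ + X]eq_bigr do rewrite mulrC.
    by rewrite sumk subrr addr0.
have -> : transport_cost H pi = transport_cost H pi' +
    t * \sum_v pi' y v * ((dist H x v)%:R - (dist H y v)%:R).
  rewrite /transport_cost mulr_sumr exchange_big [in RHS]exchange_big /=.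
  rewrite -big_split; apply: eq_bigr => v _ /=.
  rewrite -(sumk (fun u => (dist H u v)%:R)) !mulr_sumr -big_split /=.
  by apply: eq_bigr => u _; rewrite /pi; ring.
have -> : norm1 z = norm1 z' + a.
  have -> : a = `|z [set x; y]|.
    by rewrite -[LHS]gtr0_norm // /a normrM norm_incidence mulr1.
  rewrite /norm1 /wnorm (bigD1 [set x; y]) //= mul1r addrC; congr (_ + _).
  rewrite [RHS](bigD1 [set x; y]) //= /z' eqxx normr0 mulr0 add0r.
  by apply: eq_bigr => e' /negPf->.
apply: lerD => //; rewrite -ta ler_wpM2l // -pi'mu.
apply: ler_sum => v _; rewrite -[leRHS]mulr1 ler_wpM2l // lerBlDl.
by rewrite natr1 ler_nat; apply: dist_step.
Qed.

Lemma inf_min (A : classical_sets.set R) (m : R) :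
  A m -> (forall r, A r -> m <= r) -> inf A = m.
Proof.
move=> Am lbA; apply/eqP; rewrite eq_le; apply/andP; split.
  by apply: ge_inf => //; exists m => r /lbA.
by apply: lb_le_inf; [exists m|move=> r /lbA].
Qed.

Lemma product_coupling mu nu : prob_density mu -> prob_density nu ->
  coupling mu nu (fun x y => mu x * nu y).
Proof.
move=> [mu0 mu1] [nu0 nu1]; split=> [x y|x|y]; first exact: mulr_ge0.
  by rewrite -mulr_sumr nu1 mulr1.
by rewrite -mulr_suml mu1 mul1r.
Qed.

Lemma transport_cost_anti T H mu nu pi : T \subset H -> connected_graph T ->
  coupling mu nu pi -> transport_cost H pi <= transport_cost T pi.
Proof.
move=> TH cT [pi0 _ _]; apply: ler_sum => x _; apply: ler_sum => y _.
by rewrite ler_wpM2l // ler_nat dist_anti.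
Qed.

Lemma tree_coupling T mu nu z : simple_graph T -> connected_graph T ->
    indep M T -> prob_density mu -> prob_density nu ->
    flow M (fun v => mu v - nu v) T z ->
  exists2 pi, coupling mu nu pi & transport_cost T pi <= norm1 z.
Proof.
move=> sT cT iT [mu0 _] [nu0 _] fz.
have [f fdesc] := indep_potential z sT cT iT.
exact: flow_coupling fdesc _ _ fz.
Qed.

Lemma wasserstein_tree T mu nu z : simple_graph T -> connected_graph T ->
    indep M T -> prob_density mu -> prob_density nu ->
    flow M (fun v => mu v - nu v) T z ->
  wasserstein T mu nu = norm1 z.
Proof.
move=> sT cT iT dmu dnu fz; have [bz sz] := fz.
have cost_ge pi : coupling mu nu pi -> norm1 z <= transport_cost T pi.
  move=> /(coupling_flow sT cT)[c [bc sc]]; apply: le_trans.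
  rewrite /norm1 (@eq_wnorm _ _ _ z c) //.
  by apply: (flow_uniq iT) => // v; rewrite bz bc.
apply: inf_min => [|_ [pi cpi <-]]; last exact: cost_ge.
have [pi cpi le_pi] := tree_coupling sT cT iT dmu dnu fz.
by exists pi => //; apply/eqP; rewrite eq_le le_pi cost_ge.
Qed.

(** The tree metric dominates the metric of E, so an optimal coupling for T
    costs at most |z| on E, while every coupling costs at least the norm of a
    flow on E. *)
Lemma wasserstein_graph E T mu nu z : simple_graph E -> connected_graph E ->
    basis M E T -> prob_density mu -> prob_density nu ->
    flow M (fun v => mu v - nu v) T z ->
    (forall c, flow M (fun v => mu v - nu v) E c -> norm1 z <= norm1 c) ->
  wasserstein E mu nu = norm1 z.
Proof.
move=> sE cE bT dmu dnu fz min_z.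
have [TE cT _] := basis_tree sE cE bT.
have [_ iT _] := bT; have sT := simple_graphS TE sE.
have cost_ge pi : coupling mu nu pi -> norm1 z <= transport_cost E pi.
  by move=> /(coupling_flow sE cE)[c /min_z]; apply: le_trans.
apply: inf_min => [|_ [pi cpi <-]]; last exact: cost_ge.
have [pi cpi le_pi] := tree_coupling sT cT iT dmu dnu fz.
exists pi => //; apply/eqP; rewrite eq_le cost_ge // andbT.
exact: le_trans (transport_cost_anti TE cT cpi) le_pi.
Qed.

End Transport.

Theorem theorem1p3 (R : realType) (V : finType) (E : {set {set V}})
    (simpleE : simple_graph E) (connE : connected_graph E)
    (mu nu : V -> R) (hmu : prob_density mu) (hnu : prob_density nu) :
  connected (optimal_trees E mu nu) (exchange E).
Proof.
pose b v := mu v - nu v.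
have basisP T : basis (@incidence R V) E T <-> spanning_tree E T.
  by split; [apply: basis_tree|apply: tree_basis].
have /choice[x xE] : forall T, exists z,
    basis (@incidence R V) E T -> flow (@incidence R V) b T z.
  move=> T; have [/basisP[TE cT _]|nbT] := pselect (basis (@incidence R V) E T).
    have [z fz _] := coupling_flow (simple_graphS TE simpleE) cT
      (product_coupling hmu hnu).
    by exists z.
  by exists (fun=> 0).
have [T0 bT0 _] : exists2 T, basis (@incidence R V) E T & set0 \subset T.
  apply: basis_extend (sub0set _) => z _ sz e.
  by rewrite (supp_sub0 sz) ?inE.
have [T optT] := optimal_basis_exists xE bT0.
have [bT minT] := optT.
have WE : wasserstein E mu nu = norm1 (x T).
  exact: wasserstein_graph bT hmu hnu (xE T bT) minT.
have WT B : basis (@incidence R V) E B -> wasserstein B mu nu = norm1 (x B).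
  move=> bB; have [_ iB _] := bB; have /basisP[BE cB _] := bB.
  exact: wasserstein_tree (simple_graphS BE simpleE) cB iB hmu hnu (xE B bB).
have optP B : reflect (optimal_basis (@incidence R V) E b x B)
    (B \in optimal_trees E mu nu).
  rewrite !inE; apply: (iffP andP) => [[/asboolP/basisP bB /eqP]|[bB minB]].
    by rewrite WE WT // => eqB; split=> // c; rewrite eqB; apply: minT.
  split; first exact/asboolP/basisP.
  rewrite WE WT // eq_le minB ?minT //.
    have [bx sx] := xE B bB; split=> //.
    exact: subset_trans sx (basis_sub bB).
  by have [bx sx] := xE T bT; split=> //; apply: subset_trans sx (basis_sub bT).
split; first by apply/set0Pn; exists T; apply/optP.
by move=> S S' /= SX SX'; apply: (optimal_bases_connected xE optP).
Qed.
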